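(* Let $J:V(\Omega)\to\mathbb{R}$ be a functional which is continuous and coercive on the finite dimensional subspaces of $V(\Omega)$. Then the functional $\widetilde J:V_\Lambda(\Omega)\to\mathbb{R}^*$ has a minimum point. If $J$ itself has a minimizer $u$, then $u^*$ is a minimizer of $\widetilde J$.
   Context: $\Lambda$-limits. Let $\mathfrak L=\mathcal P_\omega(\mathbb R^N)$ be the family of finite subsets of $\mathbb R^N$, directed by inclusion. One fixes an ordered field $\mathbb R^*$ properly containing $\mathbb R$ such that every net $\varphi:\mathfrak L\to\mathbb R$ has a unique $\Lambda$-limit $\lim_{\lambda\uparrow\Lambda}\varphi(\lambda)\in\mathbb R^*$; every element of $\mathbb R^*$ is such a limit; the limit of an eventually constant net (constant for all $\lambda\supseteq\lambda_0$) is that constant; and $\Lambda$-limits commute with sums and products. Equivalently, there is an ultrafilter $\mathcal U$ on $\mathfrak L$ (its members are called qualified sets) containing $\{\lambda:\lambda_0\subseteq\lambda\}$ for each $\lambda_0\in\mathfrak L$, with $\mathbb R^*=\mathbb R^{\mathfrak L}/\mathcal U$, and the $\Lambda$-limit of a net is its class modulo $\mathcal U$. $\Lambda$-limits of nets of other objects are defined in the same way (classes modulo $\mathcal U$). For sets $E_\lambda$, $\lim_{\lambda\uparrow\Lambda}E_\lambda=\{\lim_{\lambda\uparrow\Lambda}\psi(\lambda):\psi(\lambda)\in E_\lambda\}$; for functions $f_\lambda$ on $E_\lambda$, $(\lim_{\lambda\uparrow\Lambda} f_\lambda)(\lim_{\lambda\uparrow\Lambda}\psi(\lambda))=\lim_{\lambda\uparrow\Lambda}f_\lambda(\psi(\lambda))$.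 For constant nets these give the natural extensions $E^*$, $f^*$; $u^*$ is the $\Lambda$-limit of the constant net $u$. Ultrafunctions. Let $\Omega\subset\mathbb R^N$ and let $V(\Omega)$ be a real vector space of functions with $\mathcal D(\Omega)\subseteq V(\Omega)\subseteq\mathcal C^0(\overline\Omega)\cap L^1(\Omega)\cap L^2(\Omega)$, where $\mathcal D(\Omega)$ denotes the compactly supported smooth functions. Fix a Hamel basis $\{e_a\}_{a\in\Omega}$ of $V(\Omega)$ indexed by the points of $\Omega$, and for $\lambda\in\mathfrak L$ put $V_\lambda(\Omega)=\mathrm{Span}\{e_a: a\in\lambda\}$ (only indices $a\in\lambda\cap\Omega$ matter). The space of ultrafunctions generated by $V(\Omega)$ is $V_\Lambda(\Omega)=\lim_{\lambda\uparrow\Lambda}V_\lambda(\Omega)\subseteq V(\Omega)^*$. For $J:V(\Omega)\to\mathbb R$, $\widetilde J$ denotes the restriction of $J^*$ to $V_\Lambda(\Omega)$. Coercive on a finite dimensional space means that $J(u)\to+\infty$ as $\|u\|\to\infty$ in that space. *)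

(* Defs.v *)
From HB Require Import structures.
From mathcomp Require Import all_boot all_order all_algebra generic_quotient.
From mathcomp Require Import finmap.
From mathcomp Require Import all_classical all_reals all_analysis.

Set Implicit Arguments.
Unset Strict Implicit.
Unset Printing Implicit Defensive.

Import Order.TTheory GRing.Theory Num.Theory.
Import numFieldNormedType.Exports.

Local Open Scope classical_set_scope.
Local Open Scope quotient_scope.
Local Open Scope ring_scope.

Record ultrafilter (L : Type) := Ultrafilter {
  qualified : set_system L;
  ultrafilterP : UltraFilter qualified
}.

#[global] Existing Instance ultrafilterP.

Section Ultrapower.
Context (L : Type) (U : ultrafilter L) (X : choiceType).

Definition ueq (phi psi : L -> X) : bool :=
  `[< qualified U [set l | phi l = psi l] >].

Lemma ueq_refl : reflexive ueq.
Proof. by move=> phi; apply/asboolP; apply: filterS filterT => l. Qed.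

Lemma ueq_sym : symmetric ueq.
Proof.
move=> phi psi; apply/asboolP/asboolP; apply: filterS => l /= ->; by [].
Qed.

Lemma ueq_trans : transitive ueq.
Proof.
move=> psi phi chi /asboolP h1 /asboolP h2; apply/asboolP.
by apply: filterS2 h1 h2 => l /= -> ->.
Qed.

Canonical ueq_equiv := EquivRel ueq ueq_refl ueq_sym ueq_trans.

Definition ultrapower := {eq_quot ueq_equiv}.

HB.instance Definition _ := Choice.on ultrapower.
HB.instance Definition _ := EqQuotient.on ultrapower.

(* The Lambda-limit of a net is its class modulo the ultrafilter. *)
Definition llim (phi : L -> X) : ultrapower := \pi_ultrapower phi.

Lemma llimP phi psi : llim phi = llim psi <-> qualified U [set l | phi l = psi l].
Proof.
split; first by move/eqmodP/asboolP.
by move=> h; apply/eqmodP/asboolP.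
Qed.

Lemma llim_repr xi : llim (repr xi) = xi.
Proof. exact: reprK. Qed.

Lemma repr_llim phi : qualified U [set l | repr (llim phi) l = phi l].
Proof. by apply/llimP; exact: llim_repr. Qed.

Definition set_llim (E : L -> set X) : set ultrapower :=
  [set xi | exists psi, (forall l, E l (psi l)) /\ xi = llim psi].

Definition star (x : X) : ultrapower := llim (fun=> x).

End Ultrapower.

Arguments set_llim {L} U {X} E _.
Arguments star {L} U {X} x.

(* Natural extension of f: it sends lim psi to lim (f o psi), see
   fun_star_llim. *)
Definition fun_star (L : Type) (U : ultrafilter L) (X Y : choiceType)
    (f : X -> Y) (xi : ultrapower U X) : ultrapower U Y :=
  llim U (f \o repr xi).

Lemma fun_star_llim (L : Type) (U : ultrafilter L) (X Y : choiceType)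
    (f : X -> Y) (phi : L -> X) :
  fun_star f (llim U phi) = llim U (f \o phi).
Proof. by apply/llimP; apply: filterS (repr_llim U phi) => l /= ->. Qed.

(* The ultrapower of a real field is an ordered field; for the reals this is
   R^*. *)
Section Hyperreals.
Context (L : Type) (U : ultrafilter L) (R : realFieldType).
Local Notation K := (ultrapower U R).
Local Notation lim := (@llim L U R).

Definition hzero : K := lim (fun=> 0).
Definition hone : K := lim (fun=> 1).
Definition hopp (x : K) : K := lim (fun l => - repr x l).
Definition hinv (x : K) : K := lim (fun l => (repr x l)^-1).
Definition hadd (x y : K) : K := lim (fun l => repr x l + repr y l).
Definition hmul (x y : K) : K := lim (fun l => repr x l * repr y l).
Definition hnorm (x : K) : K := lim (fun l => `|repr x l|).
Definition hle (x y : K) : bool := `[< qualified U [set l | repr x l <= repr y l] >].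

Lemma hadd_lim f g : hadd (lim f) (lim g) = lim (fun l => f l + g l).
Proof.
by apply/llimP; apply: filterS2 (repr_llim U f) (repr_llim U g) => l /= -> ->.
Qed.

Lemma hmul_lim f g : hmul (lim f) (lim g) = lim (fun l => f l * g l).
Proof.
by apply/llimP; apply: filterS2 (repr_llim U f) (repr_llim U g) => l /= -> ->.
Qed.

Lemma hopp_lim f : hopp (lim f) = lim (fun l => - f l).
Proof. by apply/llimP; apply: filterS (repr_llim U f) => l /= ->. Qed.

Lemma hinv_lim f : hinv (lim f) = lim (fun l => (f l)^-1).
Proof. by apply/llimP; apply: filterS (repr_llim U f) => l /= ->. Qed.

Lemma hnorm_lim f : hnorm (lim f) = lim (fun l => `|f l|).
Proof. by apply/llimP; apply: filterS (repr_llim U f) => l /= ->. Qed.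

Lemma hle_lim f g : hle (lim f) (lim g) <-> qualified U [set l | f l <= g l].
Proof.
have := repr_llim U g; have := repr_llim U f => hf hg.
split=> [/asboolP|] h; last apply/asboolP.
- by apply: filterS3 hf hg h => l /= -> ->.
- by apply: filterS3 hf hg h => l /= -> ->.
Qed.

Lemma llim_ind (P : K -> Prop) : (forall f, P (lim f)) -> forall x, P x.
Proof. by move=> h x; rewrite -(llim_repr x). Qed.

Lemma haddA : associative hadd.
Proof.
elim/llim_ind=> f; elim/llim_ind=> g; elim/llim_ind=> h.
by rewrite !hadd_lim; congr llim; apply/funext => l; rewrite addrA.
Qed.

Lemma haddC : commutative hadd.
Proof.
elim/llim_ind=> f; elim/llim_ind=> g.
by rewrite !hadd_lim; congr llim; apply/funext => l; rewrite addrC.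
Qed.

Lemma hadd0 : left_id hzero hadd.
Proof.
elim/llim_ind=> f.
by rewrite hadd_lim; congr llim; apply/funext => l; rewrite add0r.
Qed.

Lemma haddN : left_inverse hzero hopp hadd.
Proof.
elim/llim_ind=> f.
by rewrite hopp_lim hadd_lim; congr llim; apply/funext => l; rewrite addNr.
Qed.

HB.instance Definition _ :=
  GRing.isZmodule.Build (ultrapower U R) haddA haddC hadd0 haddN.

Lemma hmulA : associative hmul.
Proof.
elim/llim_ind=> f; elim/llim_ind=> g; elim/llim_ind=> h.
by rewrite !hmul_lim; congr llim; apply/funext => l; rewrite mulrA.
Qed.

Lemma hmulC : commutative hmul.
Proof.
elim/llim_ind=> f; elim/llim_ind=> g.
by rewrite !hmul_lim; congr llim; apply/funext => l; rewrite mulrC.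
Qed.

Lemma hmul1 : left_id hone hmul.
Proof.
elim/llim_ind=> f.
by rewrite hmul_lim; congr llim; apply/funext => l; rewrite mul1r.
Qed.

Lemma hmulD : left_distributive hmul hadd.
Proof.
elim/llim_ind=> f; elim/llim_ind=> g; elim/llim_ind=> h.
by rewrite !(hadd_lim, hmul_lim); congr llim; apply/funext => l; rewrite mulrDl.
Qed.

Lemma hone_neq0 : hone != hzero.
Proof.
apply/eqP => /llimP h; have [l /eqP] := filter_ex h.
by rewrite oner_eq0.
Qed.

HB.instance Definition _ :=
  GRing.Zmodule_isComNzRing.Build (ultrapower U R)
    hmulA hmulC hmul1 hmulD hone_neq0.

Lemma hmulV (x : K) : x != 0 -> hinv x * x = 1.
Proof.
elim/llim_ind: x => f f0; rewrite hinv_lim.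
rewrite [LHS]hmul_lim; apply/llimP.
have [h|] := in_ultra_setVsetC [set l | f l = 0] (ultrafilterP U).
- by move/eqP: f0; case; apply/llimP.
- by apply: filterS => l /= /eqP fl; rewrite mulVf.
Qed.

Lemma hinv0 : hinv 0 = 0.
Proof.
by rewrite [LHS]hinv_lim; congr llim; apply/funext => l; rewrite invr0.
Qed.

HB.instance Definition _ :=
  GRing.ComNzRing_isField.Build (ultrapower U R) hmulV hinv0.

Definition hlt (x y : K) : bool := (y != x) && hle x y.

Lemma hle0_add (x y : K) : hle 0 x -> hle 0 y -> hle 0 (x + y).
Proof.
elim/llim_ind: x => f; elim/llim_ind: y => g /hle_lim hf /hle_lim hg.
rewrite [_ + _]hadd_lim; apply/hle_lim.
by apply: filterS2 hf hg => l; exact: addr_ge0.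
Qed.

Lemma hle0_mul (x y : K) : hle 0 x -> hle 0 y -> hle 0 (x * y).
Proof.
elim/llim_ind: x => f; elim/llim_ind: y => g /hle_lim hf /hle_lim hg.
rewrite [_ * _]hmul_lim; apply/hle_lim.
by apply: filterS2 hf hg => l; exact: mulr_ge0.
Qed.

Lemma hle0_anti (x : K) : hle 0 x -> hle x 0 -> x = 0.
Proof.
elim/llim_ind: x => f /hle_lim h1 /hle_lim h2; apply/llimP.
by apply: filterS2 h1 h2 => l /= h1 h2; apply/eqP; rewrite eq_le h1 h2.
Qed.

Lemma hsub_ge0 (x y : K) : hle 0 (y - x) = hle x y.
Proof.
elim/llim_ind: x => f; elim/llim_ind: y => g.
rewrite [- _]hopp_lim [_ + _]hadd_lim; apply/idP/idP => /hle_lim h;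
  by apply/hle_lim; apply: filterS h => l /=; rewrite subr_ge0.
Qed.

Lemma hle0_total (x : K) : hle 0 x || hle x 0.
Proof.
elim/llim_ind: x => f; apply/orP.
have [h|h] := in_ultra_setVsetC [set l | 0 <= f l] (ultrafilterP U).
- by left; apply/hle_lim.
- by right; apply/hle_lim; apply: filterS h => l /= /negP; rewrite -ltNge => /ltW.
Qed.

Lemma hnormN (x : K) : hnorm (- x) = hnorm x.
Proof.
elim/llim_ind: x => f; rewrite [- _]hopp_lim !hnorm_lim.
by congr llim; apply/funext => l; rewrite normrN.
Qed.

Lemma hge0_norm (x : K) : hle 0 x -> hnorm x = x.
Proof.
elim/llim_ind: x => f /hle_lim h; rewrite hnorm_lim; apply/llimP.
by apply: filterS h => l; exact: ger0_norm.
Qed.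

Lemma hlt_def (x y : K) : hlt x y = (y != x) && hle x y.
Proof. by []. Qed.

HB.instance Definition _ :=
  Num.IntegralDomain_isLeReal.Build (ultrapower U R)
    hle0_add hle0_mul hle0_anti hsub_ge0 hle0_total hnormN hge0_norm hlt_def.

Lemma llim_le (f g : L -> R) : (lim f <= lim g) <-> qualified U [set l | f l <= g l].
Proof. exact: hle_lim. Qed.

End Hyperreals.

Section LebesgueRn.
Context (R : realType) (n : nat).
Local Notation E := 'rV[R]_n.+1.

Definition box (a b : E) : set E :=
  [set x | forall i, a ord0 i <= x ord0 i <= b ord0 i].

Definition box_volume (a b : E) : R := \prod_i (b ord0 i - a ord0 i).

Definition box_cover (A : set E) (ab : nat -> E * E) :=
  (forall k i, (ab k).1 ord0 i <= (ab k).2 ord0 i) /\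
  A `<=` \bigcup_k box (ab k).1 (ab k).2.

Local Open Scope ereal_scope.

(* Outer Lebesgue measure on R^N, N = n.+1, from countable covers by closed
   boxes. *)
Definition lebesgue_outer (A : set E) : \bar R :=
  ereal_inf [set \sum_(k <oo) (box_volume (ab k).1 (ab k).2)%:E |
              ab in box_cover A].

Let vol (ab : E * E) := (box_volume ab.1 ab.2)%:E.

Let vol_ge0 A ab k : box_cover A ab -> 0 <= vol (ab k).
Proof. by move=> [h _]; rewrite lee_fin; apply: prodr_ge0 => i _; rewrite subr_ge0. Qed.

Lemma lebesgue_outer0 : lebesgue_outer set0 = 0.
Proof.
apply/eqP; rewrite eq_le; apply/andP; split; last first.
  by apply: le_ereal_inf_tmp => _ [ab hab <-]; apply: nneseries_ge0 => k _ _;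
    exact: vol_ge0 hab.
apply: ereal_inf_lbound; exists (fun=> (0%R, 0%R)); first by split.
rewrite eseries0// => k _ _ /=.
by rewrite /box_volume big_ord_recl subrr mul0r.
Qed.

Lemma lebesgue_outer_ge0 A : 0 <= lebesgue_outer A.
Proof.
by apply: le_ereal_inf_tmp => _ [ab hab <-]; apply: nneseries_ge0 => k _ _;
  exact: vol_ge0 hab.
Qed.

Lemma le_lebesgue_outer : {homo lebesgue_outer : A B / A `<=` B >-> A <= B}.
Proof.
move=> A B AB; apply: ereal_inf_le_tmp => _ [ab [h1 h2] <-]; exists ab => //.
by split=> //; exact: subset_trans h2.
Qed.

Lemma lebesgue_outer_sigma_subadditive : sigma_subadditive lebesgue_outer.
Proof.
move=> A; have [[i ioo]|] := pselect (exists i, lebesgue_outer (A i) = +oo).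
  rewrite (eseries_pinfty _ _ ioo) ?leey// => k _.
  by rewrite -ltNye (lt_le_trans _ (lebesgue_outer_ge0 _)).
rewrite -forallNE => Aoo.
apply/lee_addgt0Pr => _/posnumP[e].
rewrite (le_trans _ (epsilon_trick _ _ _))//; last first.
  by move=> k; exact: lebesgue_outer_ge0.
pose P k ab := box_cover (A k) ab /\
  \sum_(j <oo) vol (ab j) <= lebesgue_outer (A k) + (e%:num / (2 ^ k.+1)%:R)%:E.
have [G PG] : {G : nat -> nat -> E * E & forall k, P k (G k)}.
  apply: (@choice _ _ P) => k; rewrite /P.
  have Afin : lebesgue_outer (A k) \is a fin_num.
    rewrite ge0_fin_numE ?lebesgue_outer_ge0//.
    by rewrite ltey; apply/eqP; exact: Aoo.
  have en1 : (0 < e%:num / (2 ^ k.+1)%:R)%R by [].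
  have [_ [ab cab <-] /ltW abS] := lb_ereal_inf_adherent en1 Afin.
  by exists ab.
have muG_ge0 x : 0 <= (vol \o uncurry G) x.
  by case: x => i j /=; exact: vol_ge0 (PG i).1.
apply: (@le_trans _ _ (\esum_(i in setT) (vol \o uncurry G) i)).
  apply: ereal_inf_lbound => /=.
  have /card_esym/ppcard_eqP[f] := card_nat2.
  exists (uncurry G \o f).
    split=> [k i|]; first by rewrite /=; case: (f k) => k1 k2; exact: (PG k1).1.1.
    move=> t [i _ Ait]; have [j _ Bijt] := (PG i).1.2 _ Ait.
    by exists (f^-1%FUN (i, j)) => //=; rewrite invK ?inE.
  rewrite -(esum_pred_image (vol \o uncurry G) _ xpredT) ?[fun=> _]set_true//.
  by rewrite image_eq.
rewrite (_ : esum _ _ = \sum_(i <oo) \sum_(j <oo ) vol (G i j)); last first.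
  pose J : nat -> set (nat * nat) := fun i => [set (i, j) | j in setT].
  rewrite (_ : setT = \bigcup_k J k); last first.
    by rewrite predeqE => -[a b]; split => // _; exists a => //; exists b.
  rewrite esum_bigcupT /=; last 2 first.
    - apply/trivIsetP => i j _ _ ij.
      rewrite predeqE => -[k m] /=; split => //= -[] [_] _ [<-{k} _].
      by move=> [m' _] [] /esym/eqP; rewrite (negbTE ij).
    - by move=> x; exact: muG_ge0.
  rewrite -(image_id [set: nat]) -fun_true esum_pred_image//; last first.
    by move=> k _; apply: esum_ge0 => x _; exact: muG_ge0.
  apply: eq_eseriesr => /= j _.
  rewrite -(esum_pred_image (vol \o uncurry G) (pair j) predT)//=; last 2 first.
    - by move=> m _; exact: (muG_ge0 (j, m)).
    - by move=> ? ? _ _; exact: (@can_inj _ _ _ snd).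
  by congr esum; rewrite predeqE => -[a b]; split; move=> [i _ <-]; exists i.
apply: lee_lim.
- apply: is_cvg_nneseries => k *.
  by apply: nneseries_ge0 => m *; exact: (muG_ge0 (k, m)).
- by apply: is_cvg_nneseries => k *; apply: adde_ge0 => //; exact: lebesgue_outer_ge0.
- by near=> k; apply: lee_sum => i _; exact: (PG i).2.
Unshelve. all: by end_near. Qed.

HB.instance Definition _ := isOuterMeasure.Build R E lebesgue_outer
  lebesgue_outer0 lebesgue_outer_ge0 le_lebesgue_outer
  lebesgue_outer_sigma_subadditive.

End LebesgueRn.

Section FunctionSpaces.
Context (R : realType) (n : nat).
Local Notation E := 'rV[R]_n.+1.

(* R^N with the sigma-algebra of Lebesgue (i.e. Caratheodory) measurable sets. *)
Definition lebesgue_space : Type := caratheodory_type (@lebesgue_outer R n).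

HB.instance Definition _ := Measurable.on lebesgue_space.

Definition lebesgue_Rn : set lebesgue_space -> \bar R := @lebesgue_outer R n.

HB.instance Definition _ := isMeasure.Build _ lebesgue_space R lebesgue_Rn
  (caratheodory_measure0 (@lebesgue_outer R n))
  (caratheodory_measure_ge0 (mu := @lebesgue_outer R n))
  (@caratheodory_measure_sigma_additive _ _ (@lebesgue_outer R n)).

(* phi is C^k: all iterated partial derivatives of order at most k exist and
   are continuous. *)
Fixpoint Ck (k : nat) (phi : E -> R) : Prop :=
  match k with
  | 0%N => continuous phi
  | k'.+1 => continuous phi /\
      forall i : 'I_n.+1,
        (forall x, derivable phi x (delta_mx ord0 i)) /\
        Ck k' (fun x => 'D_(delta_mx ord0 i) phi x)
  end.

(* D(Omega), as functions on R^N: smooth, with compact support inside Omega. *)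
Definition test_function (Omega : set E) (phi : E -> R) : Prop :=
  let supp := closure [set x | phi x != 0] in
  [/\ forall k, Ck k phi, compact supp & supp `<=` Omega].

(* A function on closure Omega is extended by 0, which does not affect its
   integral over Omega. *)
Definition in_Lp (Omega : set E) (p : nat) (f : closure Omega -> R) : Prop :=
  measurable_fun (Omega : set lebesgue_space) (valL_ 0 f) /\
  (\int[lebesgue_Rn]_(x in Omega) (`|valL_ 0 f x| ^+ p)%:E < +oo)%E.

End FunctionSpaces.

Section Subspace.
Context (R : pzRingType) (W : lmodType R) (V : submodClosed W).

Record subspace_of := SubspaceOf { fval : W; fvalP : fval \in V }.

HB.instance Definition _ := [isSub for fval].
HB.instance Definition _ := [Choice of subspace_of by <:].
HB.instance Definition _ := [SubChoice_isSubLmodule of subspace_of by <:].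

End Subspace.

Section LinearAlgebra.
Context (R : realType) (W : lmodType R).

Definition lin_span (A : set W) : set W :=
  [set v | exists (k : nat) (b : 'I_k -> W) (c : 'I_k -> R),
     (forall i, A (b i)) /\ v = \sum_i c i *: b i].

Definition hamel_basis (I : choiceType) (e : I -> W) : Prop :=
  (forall (s : seq I) (c : I -> R), uniq s ->
     \sum_(i <- s) c i *: e i = 0 -> forall i, i \in s -> c i = 0) /\
  lin_span (range e) = setT.

Definition findim_subspace (F : set W) : Prop :=
  exists2 A, finite_set A & F = lin_span A.

Definition norm_on (F : set W) (p : W -> R) : Prop :=
  [/\ forall u, F u -> p u = 0 -> u = 0,
      forall c u, F u -> p (c *: u) = `|c| * p u
    & forall u v, F u -> F v -> p (u + v) <= p u + p v].

(* All norms on a finite dimensional space are equivalent, so any one of them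
   may serve to express continuity and coercivity. *)
Definition findim_continuous (J : W -> R) : Prop :=
  forall F, findim_subspace F -> exists2 p, norm_on F p &
    forall u, F u -> forall eps, 0 < eps -> exists2 delta, 0 < delta &
      forall v, F v -> p (v - u) < delta -> `|J v - J u| < eps.

Definition findim_coercive (J : W -> R) : Prop :=
  forall F, findim_subspace F -> exists2 p, norm_on F p &
    forall M, exists r, forall u, F u -> r < p u -> M < J u.

End LinearAlgebra.

Definition is_minimizer (T : Type) (d : Order.disp_t) (K : porderType d)
    (D : set T) (f : T -> K) (x : T) : Prop :=
  D x /\ forall y, D y -> (f x <= f y)%O.

Section Ultrafunctions.
Context (R : realType) (n : nat).
Local Notation E := 'rV[R]_n.+1.

(* A family of qualified sets: an ultrafilter on the finite subsets of R^N
   containing every cone of supersets. *)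
Definition contains_cones (U : ultrafilter {fset E}) : Prop :=
  forall lambda0 : {fset E},
    qualified U [set lambda | (lambda0 `<=` lambda)%fset].

Definition function_space (Omega : set E)
    (V : submodClosed (closure Omega -> R)) : Prop :=
  (forall phi, test_function Omega phi -> sigL (closure Omega) phi \in V) /\
  (forall f, f \in V -> [/\ continuous f, in_Lp 1 f & in_Lp 2 f]).

(* e is indexed by the points of Omega, so only lambda `&` Omega matters. *)
Definition V_lambda (Omega : set E) (W : lmodType R) (e : Omega -> W)
    (lambda : {fset E}) : set W :=
  lin_span (e @` [set a | val a \in lambda]).

Definition V_Lambda (U : ultrafilter {fset E}) (Omega : set E)
    (W : lmodType R) (e : Omega -> W) : set (ultrapower U W) :=
  set_llim U (V_lambda e).

End Ultrafunctions.

Arguments V_Lambda {R n} U {Omega W} e _.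

(* Main.v *)
Require Import Defs.
From HB Require Import structures.
From mathcomp Require Import all_boot all_order all_algebra finmap.
From mathcomp Require Import all_classical all_reals all_analysis.

Set Implicit Arguments.
Unset Strict Implicit.
Unset Printing Implicit Defensive.

Import numFieldNormedType.Exports.

Local Open Scope classical_set_scope.
Local Open Scope ring_scope.

Import Order.TTheory GRing.Theory Num.Theory.

(** Minimizing over V_Lambda is the Lambda-limit of minimizing over the finite
dimensional spaces V_lambda.

On V_lambda, which is spanned by finitely many members of a Hamel basis, J is
continuous and coercive, so it attains its minimum there at some phi lambda
(V_lambda_minimizer).  An element of V_Lambda is the limit of a net psi with
psi lambda in V_lambda; as J (phi lambda) <= J (psi lambda) for every lambda,
passing to limits shows that lim phi minimizes the extension of J
(llim_minimizer).

If u minimizes J on all of V, then J u <= J (psi lambda) for any net psi, so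
the value of the extension at u^* is a lower bound.  The point u^* does belong
to V_Lambda: the finitely many basis vectors that express u lie in V_lambda as
soon as lambda contains their indices (V_lambda_exhausts), and the cone of
such lambda is qualified.

The finite dimensional step is the Weierstrass theorem read in coordinates
(free_span_minimizer).  Continuity and coercivity may be witnessed by two
different norms on the span, and neither is tied to a topology on W, so both
are transported to R^k through the coordinate map lincomb: each norm on the
span is bounded above by a multiple of the sup norm of the coordinates
(norm_on_lincomb_le), which gives continuity, and, the coordinate map being
injective, bounded below by a positive multiple of it (norm_on_lincomb_ge),
which makes J exceed J 0 outside a compact ball of R^k. *)

Section LinearCombinations.
Context (R : realType) (W : lmodType R) (k : nat) (b : 'I_k -> W).

Definition lincomb (c : 'rV[R]_k) : W := \sum_i c ord0 i *: b i.

Lemma lincomb_is_linear : linear lincomb.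
Proof.
move=> a c d; rewrite /lincomb scaler_sumr -big_split; apply: eq_bigr => i _ /=.
by rewrite !mxE scalerDl scalerA.
Qed.

HB.instance Definition _ := GRing.isLinear.Build R 'rV[R]_k W _ lincomb
  lincomb_is_linear.

(** Elements of the span are given with an arbitrary, possibly repetitive,
list of generators; collecting repetitions yields one coefficient for each
index. *)
Lemma lin_span_range : lin_span (range b) = range lincomb.
Proof.
apply/seteqP; split=> v /=; last first.
  by move=> [c _ <-]; exists k, b, (c ord0); split=> // i; exists i.
move=> [m [w [d [wb ->]]]].
have [f fE] : {f : 'I_m -> 'I_k & forall j, b (f j) = w j}.
  apply: (@choice _ _ (fun j i => b i = w j)) => j.
  by have [i _ <-] := wb j; exists i.
exists (\sum_j d j *: delta_mx ord0 (f j)) => //.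
rewrite linear_sum; apply: eq_bigr => j _; rewrite linearZ /=; congr (_ *: _).
rewrite /lincomb (bigD1 (f j)) //= mxE !eqxx scale1r big1 ?addr0 // => i /negbTE.
by move=> ne; rewrite mxE eqxx ne scale0r.
Qed.

Lemma range_lincomb_gen i : range lincomb (b i).
Proof.
rewrite -lin_span_range; exists 1%N, (fun=> b i), (fun=> 1).
by split; [move=> _; exists i | rewrite big_ord1 scale1r].
Qed.

Lemma findim_lin_span_range : findim_subspace (lin_span (range b)).
Proof. by exists (range b) => //; apply: finite_image; exact: finite_finset. Qed.

End LinearCombinations.

Lemma coord_le_norm (R : realType) k (c : 'rV[R]_k) i : `|c ord0 i| <= `|c|.
Proof.
rewrite [leRHS]/Num.norm /= mx_normrE; apply/bigmax_geP; right => /=.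
by exists (ord0, i).
Qed.

Section NormsInCoordinates.
Context (R : realType) (W : lmodType R) (k : nat) (b : 'I_k -> W).
Local Notation F := (range (lincomb b)).

Lemma norm_on0 p : norm_on F p -> p 0 = 0.
Proof.
move=> [_ pZ _]; rewrite -(scale0r 0) pZ ?normr0 ?mul0r //.
by exists 0 => //; rewrite linear0.
Qed.

Lemma norm_onN p u : norm_on F p -> F u -> p (- u) = p u.
Proof. by move=> [_ pZ _] Fu; rewrite -scaleN1r pZ // normrN1 mul1r. Qed.

Lemma norm_on_ge0 p u : norm_on F p -> F u -> 0 <= p u.
Proof.
move=> pn Fu; have [_ _ pD] := pn.
have FNu : F (- u) by case: Fu => c _ <-; exists (- c); rewrite ?linearN.
by have := pD _ _ Fu FNu; rewrite subrr norm_on0 // norm_onN // -mulr2n pmulrn_lge0.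
Qed.

Lemma norm_on_sub p u v : norm_on F p -> F u -> F v -> `|p u - p v| <= p (u - v).
Proof.
move=> pn [c _ <-] [d _ <-]; have [_ _ pD] := pn.
have FF x : F (lincomb b x) by exists x.
have tri x y : p (lincomb b x) - p (lincomb b y) <= p (lincomb b (x - y)).
  by rewrite lerBlDr -{1}(subrK y x) linearD; exact: pD.
rewrite -linearB ler_norml tri andbT lerNl opprB (le_trans (tri _ _)) //.
by rewrite -opprB linearN norm_onN.
Qed.

Lemma norm_on_lincomb_le p c : norm_on F p ->
  p (lincomb b c) <= `|c| * \sum_i p (b i).
Proof.
move=> pn; have [_ pZ pD] := pn.
have Fb := range_lincomb_gen b.
have FZ a i : F (a *: b i).
  by case: (Fb i) => d _ <-; exists (a *: d); rewrite ?linearZ.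
(* The triangle inequality holds only inside the span, so membership of the
partial sums is carried along the induction. *)
suff : F (lincomb b c) /\ p (lincomb b c) <= `|c| * \sum_i p (b i) by case.
rewrite mulr_sumr [X in F X /\ p X <= _]/lincomb; elim/big_ind2: _.
- by rewrite norm_on0 //; split=> //; exists 0 => //; rewrite linear0.
- move=> u x v y [Fu ux] [Fv vy]; split.
    by case: Fu Fv => d _ <- [d' _ <-]; exists (d + d'); rewrite ?linearD.
  by rewrite (le_trans (pD _ _ Fu Fv)) // lerD.
- move=> i _; split=> //; rewrite pZ //.
  by rewrite ler_wpM2r ?coord_le_norm // (norm_on_ge0 pn).
Qed.

(** The hypothesis on G is the pointwise continuity required by
findim_continuous.  It serves twice: for the functional J, and for a norm on
the span, which is 1-Lipschitz for itself. *)
Lemma continuous_lincomb p (G : W -> R) : norm_on F p ->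
  (forall u, F u -> forall eps, 0 < eps -> exists2 delta, 0 < delta &
     forall v, F v -> p (v - u) < delta -> `|G v - G u| < eps) ->
  continuous (G \o lincomb b).
Proof.
move=> pn Gc c; apply/(@pseudometric_normed_Zmodule.cvgrPdist_lt _ _ _ (nbhs c)) => eps eps0.
have [delta delta0 Gd] := Gc (lincomb b c) (ex_intro2 _ _ c I erefl) _ eps0.
(* The summand 1 keeps the constant positive when every b i is null. *)
pose C := \sum_i p (b i) + 1.
have C0 : 0 < C.
  rewrite ltr_wpDl // sumr_ge0 // => i _; apply: (norm_on_ge0 pn).
  exact: range_lincomb_gen.
near=> d; rewrite /= distrC; apply: Gd; first by exists d.
rewrite -linearB (le_lt_trans (norm_on_lincomb_le _ pn)) //.
apply: (@le_lt_trans _ _ (`|d - c| * C)); first by rewrite ler_wpM2l // lerDl.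
rewrite -ltr_pdivlMr // distrC.
near: d; apply: pseudometric_normed_Zmodule.cvgr_dist_lt; [exact: cvg_id | exact: divr_gt0].
Unshelve. all: by end_near. Qed.

(** The substantial half of the equivalence of norms in finite dimension: the
continuous function p \o lincomb b attains its minimum m on the compact unit
sphere of the sup norm; m is positive because lincomb b is injective, and
homogeneity extends the bound from the sphere to all of R^k. *)
Lemma norm_on_lincomb_ge p : norm_on F p -> injective (lincomb b) ->
  exists2 m, 0 < m & forall c, m * `|c| <= p (lincomb b c).
Proof.
move=> pn inj; have [p0 pZ _] := pn.
pose S := [set c : 'rV[R]_k | `|c| = 1].
have FF x : F (lincomb b x) by exists x.
have normalized c : c != 0 -> S (`|c|^-1 *: c).
  by move=> c0; rewrite /S /= normrZ normfV normr_id mulVf // normr_eq0.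
(* The unit sphere is empty when k = 0. *)
have [[c0 Sc0]|S0] := pselect (S !=set0); last first.
  exists 1 => // c; have [->|c0] := eqVneq c 0.
    by rewrite normr0 mulr0 linear0 (norm_on0 pn).
  by case: S0; exists (`|c|^-1 *: c); exact: normalized.
have pc : continuous (p \o lincomb b).
  apply: (continuous_lincomb pn) => u Fu eps eps0; exists eps => // v Fv.
  exact/le_lt_trans/norm_on_sub.
have Scompact : compact S.
  apply: bounded_closed_compact.
    by exists 1; split=> // x x1 c /= ->; exact: ltW.
  apply: (@preimage_closed _ _ (fun c : 'rV[R]_k => `|c|) [set 1]).
    by move=> c _; exact: norm_continuous.
  exact: closed_eq.
have [c] := EVT_min_rV (ex_intro _ _ Sc0) Scompact (continuous_subspaceT pc).
rewrite inE /= => c1 cmin; exists (p (lincomb b c)).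
  rewrite lt_neqAle (norm_on_ge0 pn) // andbT eq_sym; apply/eqP => /p0.
  rewrite -[X in _ = X](linear0 (lincomb b)) => /(_ (FF _))/inj c0E.
  by move: c1; rewrite c0E normr0 => /eqP; rewrite eq_sym oner_eq0.
move=> d; have [->|d0] := eqVneq d 0.
  by rewrite normr0 mulr0 linear0 (norm_on0 pn).
rewrite -ler_pdivlMr ?normr_gt0 //.
have := cmin _ (mem_set (normalized d d0)).
by rewrite /= linearZ /= pZ // normfV normr_id mulrC.
Qed.

End NormsInCoordinates.

(** Weierstrass: coercivity, used at the level J 0, confines the competitors
to a closed ball of R^k, which is compact and contains the origin. *)
Lemma free_span_minimizer (R : realType) (W : lmodType R) (k : nat)
    (b : 'I_k -> W) (J : W -> R) :
  (forall c, lincomb b c = 0 -> c = 0) ->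
  findim_continuous J -> findim_coercive J ->
  exists u, is_minimizer (lin_span (range b)) J u.
Proof.
move=> free Jcont Jcoer.
have inj : injective (lincomb b).
  move=> c d /eqP; rewrite -subr_eq0 -linearB => /eqP/free/eqP.
  by rewrite subr_eq0 => /eqP.
have [p pn Jp] := Jcont _ (findim_lin_span_range b).
have [q qn Jq] := Jcoer _ (findim_lin_span_range b).
rewrite lin_span_range in pn Jp qn Jq *.
have gc := continuous_lincomb pn Jp.
have [m m0 mq] := norm_on_lincomb_ge qn inj.
have [r Jr] := Jq (J 0).
(* For q (lincomb b c) <= r the lower bound on q gives `|c| <= r / m; the
absolute value makes the ball nonempty, since r may be negative. *)
pose B := [set c : 'rV[R]_k | `|c| <= `|r| / m].
have B0 : B 0 by rewrite /B /= normr0 divr_ge0 // ltW.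
have Bcompact : compact B.
  apply: bounded_closed_compact.
    exists (`|r| / m); split; first exact: num_real.
    by move=> x rx c /= /le_trans; apply; exact: ltW.
  apply: (@preimage_closed _ _ (fun c : 'rV[R]_k => `|c|) [set x | x <= `|r| / m]).
    by move=> c _; exact: norm_continuous.
  exact: closed_le.
have [c _ cmin] := EVT_min_rV (ex_intro _ _ B0) Bcompact (continuous_subspaceT gc).
exists (lincomb b c); split; first by exists c.
move=> _ [d _ <-]; have [dB|dB] := leP `|d| (`|r| / m).
  by apply: cmin; rewrite inE.
apply: le_trans (cmin 0 (mem_set B0)) _; rewrite /= linear0; apply/ltW/Jr.
  by exists d.
rewrite (le_lt_trans (ler_norm r)) // (lt_le_trans _ (mq d)) //.
by rewrite mulrC -ltr_pdivrMr.
Qed.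

Section LambdaApproximations.
Context (R : realType) (n : nat) (Omega : set 'rV[R]_n.+1).
Context (W : lmodType R) (e : Omega -> W).

Lemma V_lambda_minimizer (J : W -> R) (lambda : {fset 'rV[R]_n.+1}) :
  hamel_basis e -> findim_continuous J -> findim_coercive J ->
  exists u, is_minimizer (V_lambda e lambda) J u.
Proof.
move=> [free _] Jcont Jcoer.
pose s : seq Omega := pmap insub (lambda : seq _).
have us : uniq s by apply: pmap_sub_uniq; exact: fset_uniq.
pose b (i : 'I_(size s)) := e (tnth (in_tuple s) i).
have -> : V_lambda e lambda = lin_span (range b).
  rewrite /V_lambda; congr lin_span; apply/seteqP; split=> w [].
    move=> a /= al <-; have /(tnthP (in_tuple s))[i ->] : a \in s.
      by rewrite mem_pmap_sub.
    by exists i.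
  move=> i _ <-; exists (tnth (in_tuple s) i) => //=.
  by have := mem_tnth i (in_tuple s); rewrite mem_pmap_sub.
apply: free_span_minimizer => // c c0; apply/rowP => i; rewrite mxE.
(* The coefficients c, indexed by positions in s, as a function on Omega. *)
pose d (a : Omega) :=
  if insub (index a s) is Some j then c ord0 j else 0 : R.
have dE j : d (tnth (in_tuple s) j) = c ord0 j.
  by rewrite /d (tnth_nth (tnth (in_tuple s) j)) index_uniq // valK.
rewrite -dE; apply: (free s d us); last exact: mem_tnth.
by rewrite big_tnth -[RHS]c0; apply: eq_bigr => j _; rewrite dE.
Qed.

Lemma V_lambda_exhausts (u : W) : hamel_basis e ->
  exists lambda0 : {fset 'rV[R]_n.+1},
    forall lambda, (lambda0 `<=` lambda)%fset -> V_lambda e lambda u.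
Proof.
move=> [_ gen]; have : lin_span (range e) u by rewrite gen.
move=> [k [w [c [we uE]]]].
have [f fE] : {f : 'I_k -> Omega & forall j, e (f j) = w j}.
  apply: (@choice _ _ (fun j a => e a = w j)) => j.
  by have [a _ <-] := we j; exists a.
exists [fset val (f j) | j in 'I_k]%fset => lambda /fsubsetP sub.
exists k, w, c; split=> // j; exists (f j) => //=; apply: sub.
by apply/imfsetP; exists j.
Qed.

Lemma V_lambda0 (lambda : {fset 'rV[R]_n.+1}) : V_lambda e lambda 0.
Proof. by exists 0%N, (fun=> 0), (fun=> 0); split=> [[]//|]; rewrite big_ord0. Qed.

End LambdaApproximations.

Lemma llim_minimizer (R : realType) (L : Type) (U : ultrafilter L)
    (X : choiceType) (E : L -> set X) (J : X -> R) (phi : L -> X) :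
  (forall l, is_minimizer (E l) J (phi l)) ->
  is_minimizer (set_llim U E) (fun_star J) (llim U phi).
Proof.
move=> phimin; split; first by exists phi; split=> // l; case: (phimin l).
move=> _ [psi [psiE ->]]; rewrite !fun_star_llim; apply/llim_le.
by apply: filterS filterT => l _ /=; case: (phimin l) => _; apply.
Qed.

Theorem theorem24 (R : realType) (n : nat)
    (U : ultrafilter {fset 'rV[R]_n.+1}) (U_cones : contains_cones U)
    (Omega : set 'rV[R]_n.+1) (V : submodClosed (closure Omega -> R))
    (V_space : function_space V)
    (e : Omega -> subspace_of V) (e_basis : hamel_basis e)
    (J : subspace_of V -> R)
    (J_continuous : findim_continuous J) (J_coercive : findim_coercive J) :
  (exists xi, is_minimizer (V_Lambda U e) (fun_star J) xi) /\
  (forall u, is_minimizer setT J u ->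
     is_minimizer (V_Lambda U e) (fun_star J) (star U u)).
Proof.
split.
  have /choice[phi phimin] lambda :=
    V_lambda_minimizer lambda e_basis J_continuous J_coercive.
  by exists (llim U phi); exact: llim_minimizer.
move=> u [_ umin]; split; last first.
  move=> _ [psi [_ ->]]; rewrite /star !fun_star_llim; apply/llim_le.
  by apply: filterS filterT => l _ /=; exact: umin.
have [lambda0 uV] := V_lambda_exhausts u e_basis.
(* Membership in a Lambda-limit of sets asks for psi lambda in V_lambda for
every lambda, hence the value 0 where u is not yet available. *)
pose psi lambda := if `[< V_lambda e lambda u >] then u else 0.
exists psi; split.
  by move=> lambda; rewrite /psi; case: asboolP => // _; exact: V_lambda0.
apply/llimP; apply: filterS (U_cones lambda0) => lambda /uV Vu /=.
by rewrite /psi asboolT.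
Qed.
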